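(* Let $\Omega$ be the set of all simplicial subcomplexes of $\Delta_{\mathbb N}$, equipped with the $\sigma$-algebra $\mathcal A'$ generated by the sets $Z(Y,n)=\{X\in\Omega: X\cap\Delta_n=Y\}$ (for $n\ge1$ and $Y$ a subcomplex of $\Delta_n$), and with the probability measure $\mu$ on $\mathcal A'$ satisfying $\mu(Z(Y,n))=2^{-H(Y,n)}$, where $H(Y,n)=|F(Y)|+|E(Y|\Delta_n)|$. Let $\mathcal R\subseteq\Omega$ be the set of complexes isomorphic to the Rado complex. Then $\mathcal R\in\mathcal A'$ and $\mu(\mathcal R)=1$.
   Context: $\Delta_{\mathbb N}$ is the simplicial complex with vertex set $\mathbb N=\{1,2,\dots\}$ whose simplexes are all finite nonempty subsets; $\Delta_n$ is the full simplex on $\{1,\dots,n\}$. $F(Y)$ is the set of simplexes of $Y$, and $E(Y|\Delta_n)$ is the set of simplexes $\sigma$ of $\Delta_n$ with $\sigma\notin Y$ but all proper nonempty faces of $\sigma$ in $Y$. The values $\mu(Z(Y,n))$ define an additive measure on the semiring of such sets which extends to a probability measure $\mu$ on $\mathcal A'$ (it corresponds to including each vertex independently with probability $1/2$ and each simplex whose boundary is present independently with probability $1/2$). For $U\subseteq V(X)$, $X_U$ is the induced subcomplex; $\mathrm{Lk}_X(v)$ is the subcomplex of simplexes $\sigma$ with $v\notin\sigma$, $\sigma\cup\{v\}\in X$. The Rado complex is the unique (up to isomorphism) simplicial complex with a countable vertex set which is nonempty and satisfies: for every finite $U\subseteq V(X)$ and every subcomplex $A\subseteq X_U$ there exists $v\in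 V(X)\setminus U$ with $\mathrm{Lk}_X(v)\cap X_U=A$. *)

(* Defs.v *)
From HB Require Import structures.
From mathcomp Require Import all_boot all_order all_algebra finmap.
From mathcomp Require Import all_classical all_reals all_analysis.

Set Implicit Arguments.
Unset Strict Implicit.
Unset Printing Implicit Defensive.

Import Order.TTheory GRing.Theory Num.Theory.

Local Open Scope classical_set_scope.

Section Complexes.
Variable V : choiceType.
Implicit Types (X Y A : set {fset V}) (U s t : {fset V}) (v : V).

(* A complex is given by its set of simplexes. The empty complex is allowed,
   and not every point of the ambient type V need be a vertex. *)
Definition simplicial_complex X : Prop :=
  (forall s, X s -> s != fset0) /\
  (forall s t, X s -> (t `<=` s)%fset -> t != fset0 -> X t).

Definition subcomplex A X : Prop := simplicial_complex A /\ A `<=` X.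

Definition vertices X : set V := [set v | X [fset v]%fset].

Definition induced X U : set {fset V} := [set s | X s /\ (s `<=` U)%fset].

Definition link X v : set {fset V} :=
  [set s | [/\ s != fset0, v \notin s & X (v |` s)%fset]].

Definition is_Rado X : Prop :=
  [/\ simplicial_complex X,
      countable (vertices X),
      X !=set0 &
      forall U A, [set` U] `<=` vertices X -> subcomplex A (induced X U) ->
        exists v, [/\ vertices X v, v \notin U &
                      link X v `&` induced X U = A]].

End Complexes.

(* f is a total function V -> W of which only the restriction to the vertices
   of X matters. *)
Definition isomorphic (V W : choiceType)
    (X : set {fset V}) (Y : set {fset W}) : Prop :=
  exists f : V -> W, set_bij (vertices X) (vertices Y) f /\
    forall s : {fset V}, [set` s] `<=` vertices X ->
      (X s <-> Y [fset f x | x in s]%fset).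

Definition DeltaN : set {fset nat} :=
  [set s | s != fset0 /\ forall i, i \in s -> (1 <= i)%N].

Definition Delta (n : nat) : set {fset nat} :=
  [set s | s != fset0 /\ forall i, i \in s -> (1 <= i <= n)%N].

Definition Omega : Type := set_type [set X | subcomplex X DeltaN].

Lemma subcomplex_set0 : set0 \in [set X | subcomplex X DeltaN].
Proof. by rewrite inE /=; split; [split|]. Qed.

HB.instance Definition _ := Choice.on Omega.
HB.instance Definition _ := isPointed.Build Omega (exist _ set0 subcomplex_set0).

Definition Z (Y : set {fset nat}) (n : nat) : set Omega :=
  [set X | val X `&` Delta n = Y].

Definition Zsets : set (set Omega) :=
  [set B | exists (n : nat) (Y : set {fset nat}),
     [/\ (1 <= n)%N, subcomplex Y (Delta n) & B = Z Y n]].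

(* The set written E(Y|Delta_n). *)
Definition ext_faces (Y : set {fset nat}) (n : nat) : set {fset nat} :=
  [set s | [/\ Delta n s, ~ Y s &
     forall t, (t `<` s)%fset -> t != fset0 -> Y t]].

(* fset_set takes the junk value fset0 on infinite sets; Y and ext_faces Y n
   are finite when Y `<=` Delta n, the only case in which H is used. *)
Definition H (Y : set {fset nat}) (n : nat) : nat :=
  (#|` fset_set Y| + #|` fset_set (ext_faces Y n)|)%N.

Definition Rado_class (V : choiceType) (K : set {fset V}) : set Omega :=
  [set X | isomorphic (val X) K].

(* Main.v *)
Require Import Defs.
From HB Require Import structures.
From mathcomp Require Import all_boot all_order all_algebra finmap.
From mathcomp Require Import all_classical all_reals all_analysis.

(** Two complexes with the Rado property are isomorphic by back-and-forth: a
    finite partial isomorphism extends to one more vertex x by realizing the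
    image of the link of x as the link of a vertex on the other side. Hence the
    class R consists of the complexes having the Rado property, which is a
    countable conjunction of conditions indexed by m and a finite subcomplex A
    of Delta_m: if A is contained in X, then some vertex v > m has link meeting
    Delta_m exactly in A.

    For a finite family S of simplexes closed under faces and a complex Y
    contained in S, the event that X and Y agree on S has probability 2^-w, with
    w the number of simplexes of S whose boundary lies in Y; this follows from
    the case S = Delta_n by removing maximal simplexes one at a time. Taking
    for S the union of Delta_n and the cone from n+1 over Delta_m, whatever X is
    on Delta_n, the vertex n+1 realizes A with conditional probability at least
    2^-(2^m). So the probability that no v > m realizes A is 0. *)

Import Order.TTheory GRing.Theory Num.Theory.
Import numFieldNormedType.Exports.

Local Open Scope classical_set_scope.

Set Implicit Arguments.
Unset Strict Implicit.
Unset Printing Implicit Defensive.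

(** * Induction on finite sets, and images of finite sets *)

Section FiniteSets.
Variables (K K' : choiceType).

Lemma fset_U1_ind (P : {fset K} -> Prop) : P fset0 ->
  (forall x s, x \notin s -> P s -> P (x |` s)%fset) -> forall s, P s.
Proof.
move=> P0 PU s; have [n] := ubnP #|` s|%fset; elim: n s => // n IHn s.
have [->//|[x xs]] := fset_0Vmem s.
rewrite (cardfsD1 x) xs ltnS => sn.
by rewrite -(fsetD1K xs); apply: PU; [rewrite !inE eqxx|exact: IHn].
Qed.

Lemma imfset_neq0 (f : K -> K') (s : {fset K}) :
  (f @` s != fset0)%fset = (s != fset0).
Proof.
have [->|[x xs]] := fset_0Vmem s; first by rewrite imfset0 !eqxx.
have fx : f x \in (f @` s)%fset by exact: in_imfset.
by apply/fset0Pn/fset0Pn => _; [exists x|exists (f x)].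
Qed.

Lemma imfset_subset (f : K -> K') (s t : {fset K}) :
  (s `<=` t)%fset -> (f @` s `<=` f @` t)%fset.
Proof. by move=> /fsubsetP st; apply: subset_imfset. Qed.

Lemma imfset_inj_in (f : K -> K') (p s t : {fset K}) : {in p &, injective f} ->
  (s `<=` p)%fset -> (t `<=` p)%fset -> (f @` s = f @` t)%fset -> s = t.
Proof.
move=> finj.
have sub s' t' : (s' `<=` p)%fset -> (t' `<=` p)%fset ->
    (f @` s' = f @` t')%fset -> {subset s' <= t'}.
  move=> /fsubsetP sp /fsubsetP tp e x xs.
  have : f x \in (f @` s')%fset by exact: in_imfset.
  rewrite e => /imfsetP[y /= yt fxy].
  by rewrite (finj x y (sp _ xs) (tp _ yt) fxy).
move=> sp tp e; apply/fsetP => x.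
by apply/idP/idP; [exact: (sub s t)|exact: (sub t s)].
Qed.

Lemma fsubset_imfsetP (f : K -> K') (s : {fset K}) (t : {fset K'}) :
  (t `<=` f @` s)%fset -> exists2 s', (s' `<=` s)%fset & t = (f @` s')%fset.
Proof.
move=> /fsubsetP ts; exists [fset x in s | f x \in t]%fset; first exact: fset_sub.
apply/fsetP => y; apply/idP/imfsetP => [yt|[x /=]].
  have /imfsetP[x /= xs yx] := ts _ yt.
  by exists x; rewrite // !inE /= xs -yx.
by rewrite !inE /= => /andP[_ fxt] ->.
Qed.

End FiniteSets.

(** * Uniqueness of the Rado complex by back-and-forth *)

Section BackAndForth.
Variables (V W : choiceType).
Implicit Types (X : set {fset V}) (Y : set {fset W}) (p q : {fset V * W}).

(** The map is kept as its finite graph. Quantifying over subsets of the graph makes the notion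
    symmetric in [X] and [Y], and extension becomes inclusion. *)
Definition partial_iso X Y p : Prop :=
  [/\ forall z, z \in p -> vertices X z.1 /\ vertices Y z.2,
      {in p &, injective fst}, {in p &, injective snd} &
      forall q, (q `<=` p)%fset -> X (fst @` q)%fset <-> Y (snd @` q)%fset].

Lemma partial_iso0 X Y :
  simplicial_complex X -> simplicial_complex Y -> partial_iso X Y fset0.
Proof.
move=> [X0 _] [Y0 _]; split=> // q; rewrite fsubset0 => /eqP->.
rewrite !imfset0; split=> [/X0|/Y0]; by rewrite eqxx.
Qed.

(** The link of [x] among the first coordinates of [p] is carried over to [Y]; the Rado property of
    [Y] provides a new vertex [y] with that link, and [(x, y)] is added to [p]. *)
Lemma partial_iso_extend X Y p x : simplicial_complex X -> is_Rado Y ->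
  partial_iso X Y p -> vertices X x ->
  exists p', [/\ partial_iso X Y p', (p `<=` p')%fset & x \in (fst @` p')%fset].
Proof.
move=> [X0 XS] [[Y0 YS] _ _ YR] pp Xx; have [pv p1 p2 pi] := pp.
have [xp|xp] := boolP (x \in (fst @` p)%fset); first by exists p.
pose A : set {fset W} := [set t | exists q, [/\ (q `<=` p)%fset,
  link X x (fst @` q)%fset & t = (snd @` q)%fset]].
have Asub : subcomplex A (Defs.induced Y (snd @` p)%fset).
  split.
    split=> [t [q [_ [q0 _ _] ->]]|t t' [q [qp [q0 xq Xq] ->]] t't t'0].
      by move: q0; rewrite !imfset_neq0.
    have [q' q'q t'E] := fsubset_imfsetP t't.
    have q'0 : q' != fset0 by rewrite -(imfset_neq0 snd) -t'E.
    have fq'q := imfset_subset fst q'q.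
    exists q'; split=> //; first exact: fsubset_trans qp.
    split; first by rewrite imfset_neq0.
      by apply: contra xq; apply/fsubsetP.
    apply: XS Xq _ _; first exact: fsetUS.
    by apply/fset0Pn; exists x; rewrite !inE eqxx.
  move=> t [q [qp [q0 xq Xq] ->]]; split; last exact: imfset_subset.
  by apply/(pi q qp); apply: XS Xq _ q0; exact: fsubsetUr.
have Uv : [set` (snd @` p)%fset] `<=` vertices Y.
  by move=> _ /imfsetP[z /= zp ->]; have [] := pv _ zp.
have [y [Yy yp yA]] := YR _ _ Uv Asub.
exists ((x, y) |` p)%fset; split; last 2 first.
- exact: fsubsetUr.
- by apply/imfsetP; exists (x, y); rewrite //= !inE eqxx.
have xF z : z \in p -> x <> z.1.
  by move=> zp xz; move: xp; rewrite xz in_imfset.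
have yF z : z \in p -> y <> z.2.
  by move=> zp yz; move: yp; rewrite yz in_imfset.
split.
- by move=> z /fset1UP[->|/pv].
- move=> z z' /fset1UP[->|zp] /fset1UP[->|z'p] //=.
  + by move/(xF _ z'p).
  + by move/esym/(xF _ zp).
  + exact: p1.
- move=> z z' /fset1UP[->|zp] /fset1UP[->|z'p] //=.
  + by move/(yF _ z'p).
  + by move/esym/(yF _ zp).
  + exact: p2.
(* A subset without [(x, y)] is a subset of [p]. Otherwise the rest [q0] is empty, and both sides
   are vertices, or nonempty, and both sides say that the image of [q0] belongs to [A]. *)
move=> q qp'; have [xyq|xyq] := boolP ((x, y) \in q); last first.
  apply: pi; apply/fsubsetP => z zq.
  have /fset1UP[zxy|//] := fsubsetP qp' _ zq.
  by move: xyq; rewrite -zxy zq.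
rewrite -(fsetD1K xyq); set q0 := (q `\ (x, y))%fset.
have q0p : (q0 `<=` p)%fset by rewrite fsubDset.
rewrite !imfsetU1 /=.
have [->|q00] := eqVneq q0 fset0; first by rewrite !imfset0 !fsetU0.
have xq0 : x \notin (fst @` q0)%fset.
  by apply: contra xp; apply/fsubsetP/imfset_subset.
have yq0 : y \notin (snd @` q0)%fset.
  by apply: contra yp; apply/fsubsetP/imfset_subset.
split=> [Xq|Yq].
  have : A (snd @` q0)%fset.
    by exists q0; split=> //; split=> //; rewrite imfset_neq0.
  by rewrite -yA => -[[]].
have : A (snd @` q0)%fset.
  rewrite -yA; split; first by split=> //; rewrite imfset_neq0.
  split; last exact: imfset_subset.
  by apply: YS Yq _ _; [exact: fsubsetUr|rewrite imfset_neq0].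
(* Membership in [A] yields only some [q1] with the same second coordinates as [q0]; injectivity of
   [snd] on [p] gives [q1 = q0]. *)
move=> [q1 [q1p [_ _ Xq1] e]].
by rewrite (imfset_inj_in p2 q0p q1p e).
Qed.

End BackAndForth.

(** Passing to the inverse graph turns the backward step into a forward step. *)
Definition fswap (V W : choiceType) (q : {fset V * W}) : {fset W * V} :=
  [fset (z.2, z.1) | z in q]%fset.

Section Swap.
Variables (V W : choiceType).
Implicit Type q : {fset V * W}.

Lemma fst_fswap q : (fst @` fswap q = snd @` q)%fset.
Proof. by rewrite /fswap -imfset_comp. Qed.

Lemma snd_fswap q : (snd @` fswap q = fst @` q)%fset.
Proof. by rewrite /fswap -imfset_comp. Qed.

Lemma mem_fswap q z : (z \in fswap q) = ((z.2, z.1) \in q).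
Proof.
apply/imfsetP/idP => [[[a b] /= abq ->//]|zq].
by exists (z.2, z.1) => //; case: z zq.
Qed.

End Swap.

Lemma fswapK (V W : choiceType) (q : {fset V * W}) : fswap (fswap q) = q.
Proof. by apply/fsetP => -[a b]; rewrite !mem_fswap. Qed.

Lemma fswap_subset (V W : choiceType) (p q : {fset V * W}) :
  (p `<=` q)%fset -> (fswap p `<=` fswap q)%fset.
Proof. exact: imfset_subset. Qed.

Lemma partial_iso_swap (V W : choiceType) (X : set {fset V}) (Y : set {fset W})
  p : partial_iso X Y p -> partial_iso Y X (fswap p).
Proof.
move=> [pv p1 p2 pi]; split.
- by move=> z; rewrite mem_fswap => /pv[].
- move=> [a b] [a' b']; rewrite !mem_fswap /= => zp zp' e.
  by have [-> ->] := p2 _ _ zp zp' e.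
- move=> [a b] [a' b']; rewrite !mem_fswap /= => zp zp' e.
  by have [-> ->] := p1 _ _ zp zp' e.
move=> q /fswap_subset; rewrite fswapK => qp.
by apply: iff_sym; have := pi _ qp; rewrite fst_fswap snd_fswap.
Qed.

Lemma partial_iso_extend_both (V W : choiceType) (X : set {fset V})
    (Y : set {fset W}) p x y :
  is_Rado X -> is_Rado Y -> partial_iso X Y p -> vertices X x -> vertices Y y ->
  exists p', [/\ partial_iso X Y p', (p `<=` p')%fset,
    x \in (fst @` p')%fset & y \in (snd @` p')%fset].
Proof.
move=> XR YR pp Xx Yy; have [[Xc _ _ _] [Yc _ _ _]] := (XR, YR).
have [p' [p'p pp' xp']] := partial_iso_extend Xc YR pp Xx.
have [p'' [p''p pp'' yp'']] := partial_iso_extend Yc XR (partial_iso_swap p'p) Yy.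
have p'p'' : (p' `<=` fswap p'')%fset.
  by rewrite -(fswapK p'); exact: fswap_subset.
exists (fswap p''); split; rewrite ?snd_fswap //; first exact: partial_iso_swap.
- exact: fsubset_trans p'p''.
- by move: xp'; apply/fsubsetP/imfset_subset.
Qed.

(** The extension property for the empty vertex set and the empty subcomplex already produces a
    vertex. *)
Lemma is_Rado_vertex (V : choiceType) (X : set {fset V}) :
  is_Rado X -> exists x, vertices X x.
Proof.
move=> [_ _ _ XR]; have [||x [Xx _ _]] := XR fset0 set0; last by exists x.
- by move=> ?; rewrite /= inE.
- by do 2?split.
Qed.

(** Fix injective codes of the vertices by natural numbers. Stage [n] puts the vertices of code [n]
    on both sides into the partial isomorphism, and the union of the stages is the graph of the
    isomorphism. *)
Lemma is_Rado_isomorphic (V W : choiceType) (X : set {fset V})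
  (Y : set {fset W}) : is_Rado X -> is_Rado Y -> isomorphic X Y.
Proof.
move=> XR YR; have [[Xc /countable_injP[cX cXinj] _ _] _] := (XR, YR).
have [[Yc /countable_injP[cY cYinj] _ _] _] := (YR, XR).
have [x0 Xx0] := is_Rado_vertex XR; have [y0 Yy0] := is_Rado_vertex YR.
have step (np : nat * {fset V * W}) : exists p', partial_iso X Y np.2 ->
    [/\ partial_iso X Y p', (np.2 `<=` p')%fset,
      forall x, vertices X x -> cX x = np.1 -> x \in (fst @` p')%fset &
      forall y, vertices Y y -> cY y = np.1 -> y \in (snd @` p')%fset].
  have [pp|?] := pselect (partial_iso X Y np.2); last by exists fset0.
  (* The vertex of code [np.1] if there is one; otherwise [x0], for which the condition on codes is
     vacuous. *)
  have [x Xx xE] : exists2 x, vertices X x &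
      forall x', vertices X x' -> cX x' = np.1 -> x' = x.
    have [[x [Xx <-]]|N] := pselect (exists x, vertices X x /\ cX x = np.1).
      by exists x => // x' Xx'; apply: cXinj; rewrite inE.
    by exists x0 => // x' Xx' e; case: N; exists x'.
  have [y Yy yE] : exists2 y, vertices Y y &
      forall y', vertices Y y' -> cY y' = np.1 -> y' = y.
    have [[y [Yy <-]]|N] := pselect (exists y, vertices Y y /\ cY y = np.1).
      by exists y => // y' Yy'; apply: cYinj; rewrite inE.
    by exists y0 => // y' Yy' e; case: N; exists y'.
  have [p' [? ? xp' yp']] := partial_iso_extend_both XR YR pp Xx Yy.
  by exists p' => _; split=> // [x' ? /xE->|y' ? /yE->].
have [F FP] := choice step.
pose p := fix p n := if n is n'.+1 then F (n', p n') else fset0.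
have pp n : partial_iso X Y (p n).
  by elim: n => [|n /(FP (n, _))[]//]; exact: partial_iso0.
have pmono m n : (m <= n)%N -> (p m `<=` p n)%fset.
  elim: n => [|n IH]; first by rewrite leqn0 => /eqP->.
  rewrite leq_eqVlt => /predU1P[->//|/IH pmn].
  by apply: fsubset_trans pmn _; have [] := FP (n, _) (pp n).
have pmem m n z : (m <= n)%N -> z \in p m -> z \in p n.
  by move=> mn; apply/fsubsetP/pmono.
have fE x : exists y, vertices X x -> exists n, (x, y) \in p n.
  have [Xx|?] := pselect (vertices X x); last by exists y0.
  have [_ _ /(_ _ Xx erefl)/imfsetP[[a y] /= xyp xa] _] := FP (cX x, _) (pp (cX x)).
  by rewrite -xa in xyp; exists y => _; exists (cX x).+1.
have [f fP] := choice fE; exists f.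
(* The stages form a chain, so two pairs of the graph lie in a common stage, where injectivity can
   be read off. *)
have joint x x' : vertices X x -> vertices X x' ->
    exists n, (x, f x) \in p n /\ (x', f x') \in p n.
  move=> /fP[n xn] /fP[n' xn']; exists (maxn n n').
  by split; [apply: pmem xn|apply: pmem xn']; rewrite ?leq_maxl ?leq_maxr.
split.
  split.
  - by move=> x Xx; have [n xn] := fP x Xx; have [/(_ _ xn)[]] := pp n.
  - move=> x x'; rewrite !inE => Xx Xx' e.
    have [n [xn xn']] := joint _ _ Xx Xx'; have [_ _ p2 _] := pp n.
    by have [] := p2 _ _ xn xn' e.
  - move=> y Yy.
    have [_ _ _ /(_ _ Yy erefl)/imfsetP[[x b] /= xyp yb]] :=
      FP (cY y, _) (pp (cY y)).
    rewrite -yb in xyp.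
    have {}xyp : (x, y) \in p (cY y).+1 by [].
    have Xx : vertices X x by have [/(_ _ xyp)[]] := pp (cY y).+1.
    exists x => //; have [n xn] := fP x Xx.
    have [_ p1 _ _] := pp (maxn n (cY y).+1).
    have xn' := pmem _ _ _ (leq_maxl n (cY y).+1) xn.
    have xyp' := pmem _ _ _ (leq_maxr n (cY y).+1) xyp.
    by have [] := p1 _ _ xn' xyp' erefl.
move=> s sX.
(* A finite set of vertices is treated within a single stage, which then compares [s] with its
   image. *)
have [n sn] : exists n, forall x, x \in s -> (x, f x) \in p n.
  elim/fset_U1_ind: s sX => [|x s _ IH] sX; first by exists 0%N => x; rewrite inE.
  have [n sn] : exists n, forall x, x \in s -> (x, f x) \in p n.
    by apply: IH => z zs; apply: sX; rewrite /= !inE zs orbT.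
  have [n' xn] : exists n, (x, f x) \in p n.
    by apply/fP/sX; rewrite /= !inE eqxx.
  exists (maxn n n') => z /fset1UP[->|/sn].
    by apply: pmem xn; rewrite leq_maxr.
  by apply: pmem; rewrite leq_maxl.
have [_ _ _ pi] := pp n.
have gp : ([fset (x, f x) | x in s] `<=` p n)%fset.
  by apply/fsubsetP => _ /imfsetP[x /= /sn xn ->].
by have := pi _ gp; rewrite -!imfset_comp /= imfset_id.
Qed.

(** The subcomplex [A] is pushed forward along [f], realized by a vertex of [Y], and that vertex is
    pulled back by surjectivity. Since [f] is controlled only on vertices of [X], each finite set
    involved is first shown to consist of vertices. *)
Lemma isomorphic_is_Rado (V W : choiceType) (X : set {fset V})
    (Y : set {fset W}) : simplicial_complex X -> countable (vertices X) ->
  isomorphic X Y -> is_Rado Y -> is_Rado X.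
Proof.
move=> Xc Xctbl [f [[fXY finj fsurj] fiso]] YR; have [X0 XS] := Xc.
have [y0 /fsurj[x0 Xx0 _]] := is_Rado_vertex YR.
have [[Y0 YS] _ _ YRado] := YR.
have Xv s : X s -> [set` s] `<=` vertices X.
  move=> Xs x /= xs; apply: XS Xs _ _; first by rewrite fsub1set.
  by apply/fset0Pn; exists x; rewrite inE.
split=> //; first by exists [fset x0]%fset.
move=> U A UX [[A0 AS] AU].
have finjU : {in U &, injective f}.
  by move=> x y xU yU; apply: finj; rewrite inE; exact: UX.
have subv s : (s `<=` U)%fset -> [set` s] `<=` vertices X.
  by move=> /fsubsetP sU x /= /sU /UX.
pose B : set {fset W} := [set t | exists2 s, A s & t = (f @` s)%fset].
have Bsub : subcomplex B (Defs.induced Y (f @` U)%fset).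
  split; last first.
    move=> _ [s As ->]; have [Xs sU] := AU _ As.
    by split; [apply/fiso => //; exact: subv|exact: imfset_subset].
  split=> [_ [s /A0 s0 ->]|_ t [s As ->] /fsubset_imfsetP[s' s's ->]].
    by rewrite imfset_neq0.
  by rewrite imfset_neq0 => s'0; exists s' => //; exact: AS s's _.
have fUY : [set` (f @` U)%fset] `<=` vertices Y.
  by move=> _ /imfsetP[x /= /UX Xx ->]; exact: fXY.
have [_ [/fsurj[v Xv0 <-] vU vB]] := YRado _ _ fUY Bsub.
have {}vU : v \notin U by apply: contra vU; exact: in_imfset.
exists v; split=> //; apply/seteqP; split=> [s [[s0 vs Xvs] [Xs sU]]|s As].
  have [s' As' e] : B (f @` s)%fset.
    rewrite -vB; split; last first.
      by split; [apply/fiso => //; exact: subv|exact: imfset_subset].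
    split; first by rewrite imfset_neq0.
      apply/negP => /imfsetP[x /= xs fvx].
      suff vx : v = x by move: vs; rewrite vx xs.
      by apply: finj => //; rewrite inE //; exact: (Xv _ Xs).
    by rewrite -imfsetU1; apply/fiso => //; exact: Xv.
  by have [_ s'U] := AU _ As'; rewrite (imfset_inj_in finjU sU s'U e).
have [Xs sU] := AU _ As; split=> //.
have : B (f @` s)%fset by exists s.
rewrite -vB => -[[s0 fvs Yvs] _].
have vs : v \notin s by apply: contra fvs; exact: in_imfset.
split=> //; first by rewrite -(imfset_neq0 f).
apply/fiso; last by rewrite imfsetU1.
by move=> x /fset1UP[->//|]; exact: Xv.
Qed.

(** * Finite families of simplexes and the events that they determine *)

Local Notation cplx := (g_sigma_algebraType Zsets).
Local Notation simplexes := {fset {fset nat}}.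
Local Notation seg n := [fset i in iota 1 n]%fset.

Implicit Types (S T Y L A : simplexes) (s t : {fset nat}).

Definition faces (X : cplx) : set {fset nat} := val (X : Omega).

Lemma facesP (X : cplx) : subcomplex (faces X) DeltaN.
Proof. by have := valP (X : Omega); rewrite inE. Qed.

Definition Delta_fset (n : nat) : simplexes := (fpowerset (seg n) `\ fset0)%fset.

Lemma mem_seg n i : (i \in seg n) = (1 <= i <= n)%N.
Proof. by rewrite in_fset /= mem_iota add1n ltnS. Qed.

Lemma mem_Delta_fset n s : (s \in Delta_fset n) = (s != fset0) && (s `<=` seg n)%fset.
Proof. by rewrite !inE fpowersetE. Qed.

Lemma Delta_fsetE n : [set` Delta_fset n] = Delta n.
Proof.
apply/seteqP; split=> s /=; rewrite mem_Delta_fset.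
  by move=> /andP[s0 /fsubsetP sn]; split=> // i /sn; rewrite mem_seg.
by move=> [-> sn]; apply/fsubsetP => i /sn; rewrite mem_seg.
Qed.

Lemma Delta_fset_complex n : simplicial_complex [set` Delta_fset n].
Proof.
split=> [s|s t] /=; rewrite !mem_Delta_fset; first by case/andP.
by move=> /andP[_ sn] ts ->; exact: fsubset_trans sn.
Qed.

Lemma Delta_fset_subset m n : (m <= n)%N -> (Delta_fset m `<=` Delta_fset n)%fset.
Proof.
move=> mn; apply/fsubsetP => s; rewrite !mem_Delta_fset => /andP[-> sm] /=.
apply: fsubset_trans sm _; apply/fsubsetP => i; rewrite !mem_seg => /andP[->].
by move=> /leq_trans; exact.
Qed.

Lemma DeltaN_Delta s : DeltaN s -> exists n, s \in Delta_fset n.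
Proof.
move=> [s0 s1]; have [n sn] : exists n, forall i, i \in s -> (i <= n)%N.
  elim/fset_U1_ind: s {s0 s1} => [|x s _ [n sn]]; first by exists 0%N.
  exists (maxn x n) => i /fset1UP[->|/sn]; first exact: leq_maxl.
  by move=> /leq_trans; apply; exact: leq_maxr.
exists n; rewrite mem_Delta_fset s0; apply/fsubsetP => i si.
by rewrite mem_seg s1 //= sn.
Qed.

Definition face (s : {fset nat}) : set cplx := [set X | faces X s].

(** The event is empty unless [s] is a simplex of some [Delta n.+1]; then it is the union of the
    generators [Z Y n.+1] with [s] in [Y], and there are only countably many finite families [Y]. *)
Lemma measurable_face s : measurable (face s).
Proof.
have [sD|sD] := pselect (DeltaN s); last first.
  rewrite (_ : face s = set0); first exact: measurable0.
  by rewrite -subset0 => X Xs; apply: sD; have [_] := facesP X; exact.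
have [n sn] := DeltaN_Delta sD.
have {}sn : s \in Delta_fset n.+1 by apply: (fsubsetP (Delta_fset_subset _)) sn.
pose F (Y : simplexes) : set cplx :=
  if `[< subcomplex [set` Y] (Delta n.+1) >] && (s \in Y)
  then Z [set` Y] n.+1 else set0.
rewrite (_ : face s = \bigcup_Y F Y).
  apply: countable_bigcupT_measurable; first exact: countableP.
  move=> Y; rewrite /F; case: ifPn => [/andP[/asboolP Yn _]|_]; last exact: measurable0.
  by apply: sub_sigma_algebra; exists n.+1, [set` Y].
apply/seteqP; split=> [X Xs|X [Y _]].
  have [[X0 XS] XD] := facesP X.
  pose Y := [fset t in Delta_fset n.+1 | `[< faces X t >]]%fset.
  have YE : [set` Y] = faces X `&` Delta n.+1.
    rewrite -Delta_fsetE; apply/seteqP; split=> t; rewrite /= !inE /=.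
      by move=> /andP[? /asboolP].
    by move=> [? ?]; apply/andP; split=> //; apply/asboolP.
  exists Y => //; rewrite /F ifT ?YE //; apply/andP; split.
    apply/asboolP; split; last exact: subIsetr.
    split=> [t [/X0]//|t t' [Xt]].
    rewrite -Delta_fsetE /= => tn t't t'0; split; first exact: XS Xt _ _.
    by have [_] := Delta_fset_complex n.+1; apply; eassumption.
  by rewrite in_fset inE /= sn; apply/asboolP.
rewrite /F; case: ifPn => // /andP[_ sY] XY.
have : [set` Y] s by [].
by rewrite -XY => -[].
Qed.

(** For [Y] inside [S] this is the event that [X] meets [S] exactly in [Y]. Unlike in [Z], the
    family [S] is arbitrary, so it can change by one simplex at a time. *)
Definition cyl (S Y : simplexes) : set cplx :=
  [set X | forall s, s \in S -> faces X s <-> s \in Y].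

Lemma measurable_cyl S Y : measurable (cyl S Y).
Proof.
rewrite (_ : cyl S Y =
    \bigcap_(s in [set` S]) (if s \in Y then face s else ~` face s)).
  apply: fin_bigcap_measurable => [|s _]; first exact: finite_fset.
  by case: ifPn => _; [|apply: measurableC]; exact: measurable_face.
apply/seteqP; split=> X XSY s sS.
  by have := XSY s sS; case: ifPn => _ [] // h1 h2; [exact: h2|move/h1].
by have := XSY s sS; case: ifPn => _ /= h; split.
Qed.

(** Disjointness keeps the prescriptions apart: on [S] only [Y] counts in the union, on [T] only
    [L]. *)
Lemma cylU S T Y L : (Y `<=` S)%fset -> (L `<=` T)%fset -> [disjoint S & T]%fset ->
  cyl S Y `&` cyl T L = cyl (S `|` T)%fset (Y `|` L)%fset.
Proof.
move=> /fsubsetP YS /fsubsetP LT /fdisjointP ST.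
have TS s : s \in T -> s \notin S by apply: contraTN => /ST.
have SL s : s \in S -> s \notin L by move=> /ST; apply: contra => /LT.
have TY s : s \in T -> s \notin Y by move=> /TS; apply: contra => /YS.
apply/seteqP; split=> [X [XS XT] s /fsetUP[sS|sT]|X XST].
- by rewrite inE (negPf (SL _ sS)) orbF; exact: XS.
- by rewrite inE (negPf (TY _ sT)) /=; exact: XT.
split=> s sS; have := XST s; rewrite !inE sS ?orbT => /(_ isT).
- by rewrite (negPf (SL _ sS)) orbF.
- by rewrite (negPf (TY _ sS)).
Qed.

Lemma cyl_determined S Y S' Y' X X' : (S' `<=` S)%fset ->
  cyl S Y X -> cyl S Y X' -> cyl S' Y' X -> cyl S' Y' X'.
Proof.
move=> /fsubsetP S'S XS X'S XS' s sS'.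
by apply: iff_trans (XS' _ sS'); apply: iff_trans (X'S _ (S'S _ sS')) (iff_sym _);
  exact: XS (S'S _ sS').
Qed.

Lemma cylU1_face (s : {fset nat}) S Y : s \notin S ->
  cyl S Y `&` face s = cyl (s |` S)%fset (s |` Y)%fset.
Proof.
move=> sS; have ts t : t \in S -> (t == s) = false.
  by move=> tS; apply/negbTE; apply: contraNneq sS => <-.
apply/seteqP; split=> [X [XS Xs] t /fset1UP[->|tS]|X XS].
- by rewrite !inE eqxx; split.
- by rewrite !inE ts //; exact: XS.
split=> [t tS|].
- by have := XS t; rewrite !inE tS orbT ts //; exact.
- by apply/(XS s); rewrite !inE eqxx.
Qed.

Lemma cylU1_faceC (s : {fset nat}) S Y : s \notin Y ->
  cyl S Y `\` face s = cyl (s |` S)%fset Y.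
Proof.
move=> sY; apply/seteqP; split=> [X [XS Xs] t /fset1UP[->|tS]|X XS].
- by rewrite (negPf sY); split.
- exact: XS.
split=> [t tS|].
- by apply: XS; rewrite !inE tS orbT.
- by move=> /(XS s (fset1U1 s S)); apply/negP.
Qed.

(** * Boundaries and the exponent of the measure *)

Definition boundary_in (Y : simplexes) (s : {fset nat}) : bool :=
  all (fun t => [|| t == fset0, t == s | t \in Y]) (fpowerset s).

Lemma boundary_inP Y s :
  reflect (forall t, (t `<` s)%fset -> t != fset0 -> t \in Y) (boundary_in Y s).
Proof.
apply: (iffP allP) => sY t.
  rewrite fproperEneq => /andP[ts tls] t0.
  by have := sY t; rewrite fpowersetE tls (negPf t0) (negPf ts); exact.
rewrite fpowersetE => ts; have [//|t0] := eqVneq t fset0.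
by have [//|tns /=] := eqVneq t s; apply: sY => //; rewrite fproperEneq tns.
Qed.

(** This generalizes [H] from [Delta n] to any finite family [S]: it counts the independent coin
    tosses made on [S]. *)
Definition weight (S Y : simplexes) : nat :=
  #|` [fset s in S | boundary_in Y s]%fset|.

(** The simplexes with boundary in [Y] are split by membership in [Y]: those inside are all of [Y],
    as [Y] is closed under faces, and those outside are the external faces. *)
Lemma H_weight n Y : simplicial_complex [set` Y] -> (Y `<=` Delta_fset n)%fset ->
  H [set` Y] n = weight (Delta_fset n) Y.
Proof.
move=> [Y0 YS] /fsubsetP Yn; rewrite /H set_fsetK.
set A := [fset s in Delta_fset n | boundary_in Y s]%fset.
rewrite (_ : ext_faces _ n = [set` (A `\` Y)%fset]); last first.
  rewrite /ext_faces -Delta_fsetE; apply/seteqP; split=> s /=.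
    move=> [sn /negP sY sb]; rewrite in_fsetD sY in_fset inE /= sn.
    exact/boundary_inP.
  rewrite in_fsetD in_fset inE /= => /and3P[/negP sY sn /boundary_inP sb].
  by split.
rewrite set_fsetK /weight -/A -(cardfsID Y A); congr (#|` _|%fset + _)%N.
apply/fsetP => s; rewrite in_fsetI in_fset inE /=.
apply/idP/andP => [sY|[]//]; split=> //; rewrite Yn //=.
by apply/boundary_inP => t /fproper_sub ts t0; exact: YS sY ts t0.
Qed.

Lemma complexU1 (s : {fset nat}) Y : simplicial_complex [set` Y] -> s != fset0 ->
  boundary_in Y s -> simplicial_complex [set` (s |` Y)%fset].
Proof.
move=> [Y0 YS] s0 /boundary_inP sb; split=> [t /= /fset1UP[->//|/Y0//]|].
move=> t t' /= /fset1UP[->|tY] t't t'0; apply/fset1UP.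
  have [->|t's] := eqVneq t' s; [by left|right].
  by apply: sb => //; rewrite fproperEneq t's.
by right; exact: YS tY t't t'0.
Qed.

Lemma weightU1 (s : {fset nat}) S Y : s \notin S ->
  weight (s |` S)%fset Y = (boundary_in Y s + weight S Y)%N.
Proof.
move=> sS; rewrite /weight; have [sb|sb] := boolP (boundary_in Y s).
  rewrite (_ : [fset _ in _ | _]%fset =
    s |` [fset t in S | boundary_in Y t])%fset; last first.
    apply/fsetP => t; rewrite !inE /= ?inE.
    by have [->|//] := eqVneq t s; rewrite sb.
  by rewrite cardfsU1 !inE (negPf sS).
rewrite add0n; congr #|` _|%fset.
apply/fsetP => t; rewrite !inE /= ?inE.
by have [->|//] := eqVneq t s; rewrite (negPf sb) !andbF.
Qed.

Lemma weight_eq S Y Y' : {in S, forall s, boundary_in Y s = boundary_in Y' s} ->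
  weight S Y = weight S Y'.
Proof.
move=> YY'; rewrite /weight; congr #|` _|%fset; apply/fsetP => s.
by rewrite !inE /=; have [/YY'->//|//] := boolP (s \in S).
Qed.

(** * Cones, and the Rado property as a countable conjunction. Each base used below contains
    [fset0], which contributes the vertex [v] itself *)

Definition cone (v : nat) S : simplexes := [fset v |` s | s in S]%fset.

Lemma mem_cone v S s : v \notin s -> {in S, forall t, v \notin t} ->
  ((v |` s)%fset \in cone v S) = (s \in S).
Proof.
move=> vs vS; apply/imfsetP/idP => [[t /= tS e]|sS]; last by exists s.
by rewrite -(fsetU1K vs) e fsetU1K // vS.
Qed.

(* The event that v is a vertex whose link meets Delta_m exactly in A. *)
Definition good m A v : set cplx :=
  cyl (cone v (fpowerset (seg m))) (cone v (fset0 |` A)%fset).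

Lemma notin_subset_seg m v s : (m < v)%N -> (s `<=` seg m)%fset -> v \notin s.
Proof.
move=> mv /fsubsetP sm; apply/negP => /sm; rewrite mem_seg.
by rewrite (leqNgt v) mv andbF.
Qed.

Lemma notin_fsetU1_Delta m v A : (m < v)%N -> (A `<=` Delta_fset m)%fset ->
  {in (fset0 |` A)%fset, forall t, v \notin t}.
Proof.
move=> mv /fsubsetP Am t /fset1UP[->|/Am]; first by rewrite inE.
by rewrite mem_Delta_fset => /andP[_]; exact: notin_subset_seg.
Qed.

Lemma goodP m A v (X : cplx) : (m < v)%N -> (A `<=` Delta_fset m)%fset ->
  good m A v X <-> vertices (faces X) v /\
    forall s, s \in Delta_fset m -> faces X (v |` s)%fset <-> s \in A.
Proof.
move=> mv Am; have vA := notin_fsetU1_Delta mv Am.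
have mem s : (s `<=` seg m)%fset ->
    ((v |` s)%fset \in cone v (fset0 |` A)%fset) = (s \in (fset0 |` A)%fset).
  by move=> /(notin_subset_seg mv) vs; exact: mem_cone.
split=> [gX|[Xv XA] _ /imfsetP[s /= + ->]].
  have XA s : (s `<=` seg m)%fset ->
      faces X (v |` s)%fset <-> s \in (fset0 |` A)%fset.
    move=> sm; rewrite -mem //; apply: gX; apply/imfsetP; exists s => //=.
    by rewrite fpowersetE.
  split; first by rewrite /vertices /= -(fsetU0 [fset v]%fset); apply/XA;
    rewrite ?fsub0set ?fset1U1.
  move=> s; rewrite mem_Delta_fset => /andP[s0 sm].
  by apply: iff_trans (XA s sm) _; rewrite in_fset1U (negPf s0).
rewrite fpowersetE => sm; rewrite mem //.
have [->|s0] := eqVneq s fset0.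
  by rewrite fsetU0 fset1U1; split.
by rewrite in_fset1U (negPf s0) /=; apply: XA; rewrite mem_Delta_fset s0.
Qed.

(** In one direction the extension property is applied to all vertices of [X] up to [m]; in the
    other, a given [U] is enclosed in some [seg m], and a realization over [Delta m] restricts to
    [U]. *)
Lemma is_Rado_good (X : cplx) : is_Rado (faces X) <->
  forall m A, simplicial_complex [set` A] -> (A `<=` Delta_fset m)%fset ->
    [set` A] `<=` faces X -> exists2 v, (m < v)%N & good m A v X.
Proof.
have [[X0 XS] XD] := facesP X.
have vertexE s i : faces X s -> i \in s -> vertices (faces X) i.
  move=> Xs si; apply: XS Xs _ _; first by rewrite fsub1set.
  by apply/fset0Pn; exists i; rewrite inE.
have vertex1 i : vertices (faces X) i -> (1 <= i)%N.
  by move=> /XD[_]; apply; rewrite inE.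
split=> [[_ _ _ XR] m A Ac Am AX|Xgood].
  pose U := [fset i in seg m | `[< vertices (faces X) i >]]%fset.
  have memU i : i \in U <-> i \in seg m /\ vertices (faces X) i.
    rewrite in_fset inE /=; split=> [/andP[? /asboolP]//|[im Xi]].
    by rewrite im; apply/asboolP.
  have subU s : s \in Delta_fset m -> faces X s -> (s `<=` U)%fset.
    rewrite mem_Delta_fset => /andP[_ /fsubsetP sm] Xs.
    by apply/fsubsetP => i si; apply/memU; split; [exact: sm|exact: vertexE si].
  have [||v [Xv vU vA]] := XR U [set` A].
  - by move=> i /memU[].
  - split=> // s sA; split; first exact: AX.
    by apply: subU; [exact: (fsubsetP Am)|exact: AX].
  (* Every vertex of [X] up to [m] is in [U], so a vertex outside [U] exceeds [m]. *)
  have mv : (m < v)%N.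
    rewrite ltnNge; apply: contra vU => vm; apply/memU; split=> //.
    by rewrite mem_seg vm vertex1.
  exists v => //; apply/goodP => //; split=> // s sm.
  have vs : v \notin s.
    by move: sm; rewrite mem_Delta_fset => /andP[_]; exact: notin_subset_seg.
  split=> [Xvs|sA]; last first.
    by have : [set` A] s by []; rewrite -vA => -[[]].
  have s0 : s != fset0 by move: sm; rewrite mem_Delta_fset => /andP[].
  suff : [set` A] s by [].
  have Xs : faces X s by apply: XS Xvs _ s0; exact: fsubsetUr.
  by rewrite -vA; split=> //; split=> //; exact: subU.
have ext (U : {fset nat}) (A : set {fset nat}) : [set` U] `<=` vertices (faces X) ->
    subcomplex A (Defs.induced (faces X) U) ->
    exists v, [/\ vertices (faces X) v, v \notin U &
      link (faces X) v `&` Defs.induced (faces X) U = A].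
  move=> UX [[A0 AS] AU].
  have [m Um] : exists m, (U `<=` seg m)%fset.
    have [->|U0] := eqVneq U fset0; first by exists 0%N; rewrite fsub0set.
    have [|m] := @DeltaN_Delta U; first by split=> // i /UX; exact: vertex1.
    by rewrite mem_Delta_fset => /andP[_ ?]; exists m.
  pose B := [fset s in fpowerset U | `[< A s >]]%fset.
  have memB s : s \in B <-> A s.
    rewrite in_fset inE /= fpowersetE; split=> [/andP[_ /asboolP]//|As].
    by have [_ ->] := AU _ As; apply/asboolP.
  have BE : [set` B] = A by apply/seteqP; split=> s /memB.
  have Bm : (B `<=` Delta_fset m)%fset.
    apply/fsubsetP => s /memB As; rewrite mem_Delta_fset A0 //.
    by apply: fsubset_trans Um; have [] := AU _ As.
  have [||v mv /(goodP _ mv Bm)[Xv XvB]] := Xgood m B _ Bm; first by rewrite BE.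
    by rewrite BE => s /AU[].
  exists v; split=> //; first exact: notin_subset_seg Um.
  have subm s : s != fset0 -> (s `<=` U)%fset -> s \in Delta_fset m.
    by move=> s0 sU; rewrite mem_Delta_fset s0; exact: fsubset_trans Um.
  apply/seteqP; split=> [s [[s0 _ Xvs] [_ sU]]|s As].
    by apply/memB/XvB => //; exact: subm.
  have [Xs sU] := AU _ As; split=> //; have sm := subm _ (A0 _ As) sU.
  split; first exact: A0.
  - by move: sm; rewrite mem_Delta_fset => /andP[_]; exact: notin_subset_seg.
  - by apply/XvB => //; apply/memB.
split=> //; first exact: countableP.
have [||v [Xv _ _]] := ext fset0 set0.
- by move=> i; rewrite /= inE.
- by do 2?split.
by exists [fset v]%fset.
Qed.

(** * Measures of cylinder events *)

Section RandomComplex.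
Variables (R : realType) (mu : probability cplx R).
Local Open Scope ring_scope.
Hypothesis mu_Z : forall (n : nat) (Y : set {fset nat}),
  (1 <= n)%N -> subcomplex Y (Delta n) -> mu (Z Y n) = (2 ^- (H Y n))%:E.

Lemma mu_cyl_Delta n Y : (1 <= n)%N ->
  simplicial_complex [set` Y] -> (Y `<=` Delta_fset n)%fset ->
  mu (cyl (Delta_fset n) Y) = (2 ^- weight (Delta_fset n) Y)%:E.
Proof.
move=> n1 Yc Yn; rewrite -H_weight // -mu_Z //; last first.
  by split=> //; rewrite -Delta_fsetE; apply/fsubsetP.
congr (mu _); rewrite /Z -Delta_fsetE; apply/seteqP; split=> X /= XY.
  apply/seteqP; split=> s /=; first by move=> [Xs sn]; apply/XY.
  by move=> sY; have sn := fsubsetP Yn _ sY; split=> //; apply/XY.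
move=> s sn; split=> [Xs|sY]; first by have : [set` Y] s by rewrite -XY.
by have : [set` Y] s by []; rewrite -XY => -[].
Qed.

Lemma mu_face_split s (E : set cplx) : measurable E ->
  mu E = (mu (E `\` face s) + mu (E `&` face s))%E.
Proof. by move=> mE; apply: measureDI => //; exact: measurable_face. Qed.

(** Induction on the number of simplexes of [Delta n.+1] missing from [S]. The event is split by the
    presence of one missing simplex [s]: if its boundary lies in [Y], both halves have weight one
    more; if not, [s] cannot be present and the weight is unchanged. *)
Lemma mu_cyl n S Y : simplicial_complex [set` S] -> (S `<=` Delta_fset n.+1)%fset ->
  simplicial_complex [set` Y] -> (Y `<=` S)%fset ->
  mu (cyl S Y) = (2 ^- weight S Y)%:E.
Proof.
have [k] := ubnP #|` Delta_fset n.+1 `\` S|%fset.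
elim: k S Y => // k IHk S Y Sk Sc Sn Yc YS.
have [DS|[s0 s0D]] := fset_0Vmem (Delta_fset n.+1 `\` S)%fset.
  have -> : S = Delta_fset n.+1.
    by apply/eqP; rewrite eqEfsubset Sn /= -fsetD_eq0 DS.
  apply: mu_cyl_Delta => //; exact: fsubset_trans Sn.
(* A missing simplex of least dimension has its whole boundary in S. *)
have [s sD smin] : exists2 s, s \in (Delta_fset n.+1 `\` S)%fset &
    forall t, t \in (Delta_fset n.+1 `\` S)%fset -> (#|` s| <= #|` t|)%N.
  have ex : exists m, has (fun s => #|` s|%fset == m) (Delta_fset n.+1 `\` S)%fset.
    by exists #|` s0|%fset; apply/hasP; exists s0.
  case: (ex_minnP ex) => m /hasP[s sD /eqP sm] mmin; exists s => // t tD.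
  by rewrite sm; apply: mmin; apply/hasP; exists t.
move: (sD); rewrite in_fsetD => /andP[sS sn].
have [Dn0 DnS] := Delta_fset_complex n.+1.
have s_neq0 : s != fset0 by exact: (Dn0 s sn).
have sb : boundary_in S s.
  apply/boundary_inP => t ts t0; apply: contraT => tS.
  have /smin : t \in (Delta_fset n.+1 `\` S)%fset.
    by rewrite in_fsetD tS /=; exact: DnS sn (fproper_sub ts) t0.
  by rewrite leqNgt fproper_ltn_card.
have Sc' := complexU1 Sc s_neq0 sb.
have Sn' : (s |` S `<=` Delta_fset n.+1)%fset by rewrite fsubUset fsub1set sn.
have Sk' : (#|` Delta_fset n.+1 `\` (s |` S)|%fset < k)%N.
  move: Sk; rewrite ltnS; apply: leq_trans.
  rewrite (cardfsD1 s (_ `\` S)%fset) sD add1n ltnS.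
  apply: fsubset_leq_card; apply/fsubsetP => t.
  by rewrite !in_fsetD !inE negb_or -!andbA => /and3P[-> -> ->].
have sY : s \notin Y by apply: contra sS; apply/fsubsetP.
have YS' : (Y `<=` s |` S)%fset by apply: fsubset_trans YS (fsubsetUr _ _).
rewrite (mu_face_split s (measurable_cyl S Y)).
rewrite cylU1_faceC // IHk // weightU1 //.
have [sbY|sbY] := boolP (boundary_in Y s); last first.
  rewrite (_ : cyl S Y `&` face s = set0) ?measure0 ?adde0 ?add0n //.
  rewrite -subset0 => X [XS Xs]; apply: (negP sbY); apply/boundary_inP => t ts t0.
  have [[_ Xdown] _] := facesP X.
  apply/(XS t); first exact: (boundary_inP _ _ sb).
  exact: Xdown Xs (fproper_sub ts) t0.
rewrite cylU1_face // IHk //; last 2 first.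
- exact: complexU1.
- exact: fsetUS.
rewrite weightU1 // (_ : boundary_in _ s = true); last first.
  by apply/boundary_inP => t ts t0; rewrite inE (boundary_inP _ _ sbY) ?orbT.
(* Adding [s] to [Y] affects no boundary of a simplex of [S]: as [S] is closed under faces and omits
   [s], no simplex of [S] has [s] as a face. *)
rewrite (@weight_eq S (s |` Y)%fset Y) => [|t tS].
  rewrite add1n -EFinD exprS invfM -mulrDl; congr (_%:E).
  by rewrite -div1r -splitr mul1r.
apply/boundary_inP/boundary_inP => tb u ut u0; last by rewrite inE tb ?orbT.
have /fset1UP[us|//] := tb u ut u0.
have [_ Sdown] := Sc.
by move: sS; rewrite -us (Sdown t u tS (fproper_sub ut) u0).
Qed.

(** The cylinders over [S] partition the space, so an inequality on each of them sums up. This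
    replaces conditioning on the trace of [X] on [S]. *)
Lemma mu_le_cyl (S : simplexes) (E F : set cplx) (r : R) :
  measurable E -> measurable F ->
  (forall Y, (Y `<=` S)%fset ->
    (mu (E `&` cyl S Y) <= r%:E * mu (F `&` cyl S Y))%E) ->
  (mu E <= r%:E * mu F)%E.
Proof.
elim/fset_U1_ind: S E F => [|s S sS IH] E F mE mF EF.
  have := EF fset0 (fsubset_refl _).
  by rewrite (_ : cyl _ _ = setT) ?setIT //; apply/seteqP; split.
rewrite (mu_face_split s mE) (mu_face_split s mF).
rewrite ge0_muleDr //; apply: leeD.
- apply: IH => [||Y YS]; try exact: (measurableD _ (measurable_face s)).
  rewrite !setDE -!setIA !(setIC (~` _)) -!setDE cylU1_faceC.
    by apply: EF; apply: fsubset_trans YS (fsubsetUr _ _).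
  by apply: contra sS; apply/fsubsetP.
- apply: IH => [||Y YS]; try exact: (measurableI _ _ _ (measurable_face s)).
  rewrite -!setIA !(setIC (face s)) cylU1_face //.
  by apply: EF; exact: fsetUS.
Qed.


(** The intersection is again a cylinder, over [Delta n] together with the cone from [n.+1] over all
    subsets of [seg m]. The cone has at most [2 ^ m] members, which bounds the increase of the
    weight. *)
Lemma mu_cyl_good m n A Y : (m <= n)%N ->
  simplicial_complex [set` A] -> (A `<=` Delta_fset m)%fset ->
  simplicial_complex [set` Y] -> (Y `<=` Delta_fset n)%fset -> (A `<=` Y)%fset ->
  ((2 ^- (2 ^ m))%:E * mu (cyl (Delta_fset n) Y) <=
   mu (cyl (Delta_fset n) Y `&` good m A n.+1))%E.
Proof.
move=> mn [A0 AS] Am Yc Yn /fsubsetP AY; have [Y0 YS] := Yc.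
rewrite /good; set S := Delta_fset n; set P := fpowerset _.
have PE s : (s \in P) = (s `<=` seg m)%fset by rewrite fpowersetE.
set T := cone _ P; set L := cone _ _.
have Sc : simplicial_complex [set` S] := Delta_fset_complex n.
have [S0 SS] := Sc.
have nS s : s \in S -> n.+1 \notin s.
  by rewrite mem_Delta_fset => /andP[_]; exact: notin_subset_seg.
have mS s : s != fset0 -> (s `<=` seg m)%fset -> s \in S.
  by move=> s0 sm; apply: (fsubsetP (Delta_fset_subset mn)); rewrite mem_Delta_fset s0.
have LT : (L `<=` T)%fset.
  apply/fsubsetP => _ /imfsetP[s /= sA ->]; apply: in_imfset; rewrite /= PE.
  case/fset1UP: sA => [->|/(fsubsetP Am)]; first exact: fsub0set.
  by rewrite mem_Delta_fset => /andP[].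
have ST : [disjoint S & T]%fset.
  apply/fdisjointP => s /nS; apply: contra => /imfsetP[t _ ->].
  exact: fset1U1.
(* Subsets of {n+1} u s either contain n+1 and lie in the cone, or lie in s. *)
have cone_complex (B C : simplexes) : simplicial_complex [set` B] ->
    (forall s t, s \in C -> (t `<=` s)%fset -> t \in C) ->
    (forall s, s \in C -> s != fset0 -> s \in B) ->
    simplicial_complex [set` (B `|` cone n.+1 C)%fset].
  move=> [B0 BS] CS CB; split=> [s /= /fsetUP[/B0//|/imfsetP[t _ ->]]|].
    by apply/fset0Pn; exists n.+1; exact: fset1U1.
  move=> s t /= /fsetUP[sB|/imfsetP[u /= uC ->]] tu t0; apply/fsetUP.
    by left; exact: BS sB tu t0.
  have tu' : (t `\ n.+1 `<=` u)%fset by rewrite fsubDset.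
  have [nt|nt] := boolP (n.+1 \in t); [right|left].
    by rewrite -(fsetD1K nt); apply: in_imfset; exact: CS uC tu'.
  by apply: CB t0; apply: CS uC _; rewrite (mem_fsetD1 nt) in tu'.
have STc : simplicial_complex [set` (S `|` T)%fset].
  apply: cone_complex => // [s t|s]; rewrite !PE; last by move=> ? ?; exact: mS.
  by move=> sm ts; exact: fsubset_trans sm.
have YLc : simplicial_complex [set` (Y `|` L)%fset].
  apply: cone_complex => // [s t /fset1UP[->|sA]|s /fset1UP[->|/AY//]].
  - by rewrite fsubset0 => /eqP->; exact: fset1U1.
  - move=> ts; have [->|t0] := eqVneq t fset0; first exact: fset1U1.
    by apply/fset1UP; right; exact: AS sA ts t0.
  - by rewrite eqxx.
have STn : (S `|` T `<=` Delta_fset n.+2)%fset.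
  rewrite fsubUset (Delta_fset_subset (leq_trans (leqnSn _) (leqnSn _))) /=.
  apply/fsubsetP => _ /imfsetP[s /= + ->]; rewrite PE => /fsubsetP sm.
  rewrite mem_Delta_fset; apply/andP; split.
    by apply/fset0Pn; exists n.+1; exact: fset1U1.
  apply/fsubsetP => i /fset1UP[->|/sm]; rewrite !mem_seg ?leqnSn //.
  by move=> /andP[-> /leq_trans->//]; rewrite ltnW // ltnW.
have Sn : (S `<=` Delta_fset n.+1)%fset by exact: Delta_fset_subset.
rewrite cylU // (mu_cyl Sc Sn Yc Yn) (mu_cyl STc STn YLc (fsetUSS Yn LT)).
rewrite -EFinM lee_fin -invfM -exprD lef_pV2 ?posrE ?exprn_gt0 //.
apply: ler_weXn2l; first by rewrite ler1n.
have Tm : (#|` T| <= 2 ^ m)%N.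
  apply: leq_trans (leq_imfset_card _ _ _) _.
  rewrite /= -(_ : #|` P| = 2 ^ m)%N //.
  by rewrite card_fpowerset card_fseq undup_id ?iota_uniq // size_iota.
apply: leq_trans (leq_add Tm (leqnn _)).
rewrite /weight addnC -cardfsUI; apply: leq_trans (leq_addr _ _).
apply: fsubset_leq_card; apply/fsubsetP => s.
rewrite in_fset inE /= => /andP[/fsetUP[sS|sT] sb]; apply/orP; last by right.
(* Faces of a simplex of [S] stay in [S], away from the cone, so a boundary contained in the union
   of [Y] and [L] is contained in [Y]. *)
left; rewrite in_fset inE /= sS; apply/boundary_inP => t ts t0.
have /fsetUP[//|/(fsubsetP LT) tT] := boundary_inP _ _ sb t ts t0.
have tS := SS _ _ sS (fproper_sub ts) t0.
by have := fdisjointP ST _ tS; rewrite tT.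
Qed.

(** * Almost surely some vertex realizes a given subcomplex. In [bad], the base event [cyl A A] says
    that [X] contains [A], and stage [k] has tested the vertices from [m.+1] to [m + k] *)

Fixpoint bad m A k : set cplx :=
  if k is k'.+1 then bad m A k' `\` good m A (m + k').+1 else cyl A A.

Lemma measurable_bad m A k : measurable (bad m A k).
Proof.
elim: k => [|k IH]; first exact: measurable_cyl.
by apply: measurableD => //; exact: measurable_cyl.
Qed.

Lemma bad_cyl m A k : bad m A k `<=` cyl A A.
Proof. by elim: k => [//|k IH] X [/IH]. Qed.

(** All simplexes examined by stage [k] have vertices at most [m + k]. *)
Lemma bad_determined m A k Y X X' : (A `<=` Delta_fset m)%fset ->
  cyl (Delta_fset (m + k)) Y X -> cyl (Delta_fset (m + k)) Y X' ->
  bad m A k X -> bad m A k X'.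
Proof.
move=> Am XY X'Y.
have det n S B : (n <= m + k)%N -> (S `<=` Delta_fset n)%fset ->
    cyl S B X <-> cyl S B X'.
  move=> nmk Sn; have {}Sn := fsubset_trans Sn (Delta_fset_subset nmk).
  by split; apply: cyl_determined; eassumption.
suff : forall j, (j <= k)%N -> bad m A j X -> bad m A j X' by exact.
elim=> [_|j IH jk [/(IH (ltnW jk))bX' gX]] /=.
  by move=> ?; apply/det; [|exact: Am|]; rewrite ?leq_addr.
split=> // gX'; apply: gX; apply/(det (m + j).+1) => //.
  by rewrite -addnS leq_add2l.
apply/fsubsetP => _ /imfsetP[s /= + ->]; rewrite fpowersetE => /fsubsetP sm.
rewrite mem_Delta_fset; apply/andP; split.
  by apply/fset0Pn; exists (m + j).+1; exact: fset1U1.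
apply/fsubsetP => i /fset1UP[->|/sm]; rewrite !mem_seg ?leqnn //.
by move=> /andP[-> /leq_trans->//]; rewrite ltnW // ltnS leq_addr.
Qed.

(** On each cylinder over [Delta (m + k)] the event [bad m A k] is empty or everything. In the
    second case the next vertex is good on at least the fraction [2 ^- (2 ^ m)] of the cylinder. *)
Lemma mu_badS m A k : simplicial_complex [set` A] -> (A `<=` Delta_fset m)%fset ->
  (mu (bad m A k.+1) <= (1 - 2 ^- (2 ^ m))%:E * mu (bad m A k))%E.
Proof.
move=> Ac Am; apply: (@mu_le_cyl (Delta_fset (m + k))).
- exact: measurable_bad.
- exact: measurable_bad.
move=> Y Yn; set C := cyl _ _.
have [[X0 [X0bad X0C]]|noX] := pselect (bad m A k `&` C !=set0); last first.
  have badC : bad m A k `&` C = set0.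
    by rewrite -subset0 => X XC; apply: noX; exists X.
  by rewrite /= !setDE setIAC badC set0I measure0 mule0.
have Cbad : C `<=` bad m A k.
  by move=> X XC; exact: bad_determined Am X0C XC X0bad.
(* The family [Y] was arbitrary; being the trace of the complex [X0] on [Delta (m + k)], it is a
   complex, and it contains [A] because [X0] is bad. *)
have [[X00 X0S] _] := facesP X0.
have memY s : s \in Y <-> s \in Delta_fset (m + k) /\ faces X0 s.
  split=> [sY|[sn]]; last exact: (X0C s sn).1.
  by have sn := fsubsetP Yn _ sY; split=> //; exact: (X0C s sn).2.
have Yc : simplicial_complex [set` Y].
  have [_ DS] := Delta_fset_complex (m + k).
  split=> [s /memY[_ /X00]//|s t /memY[sn Xs] ts t0].
  by apply/memY; split; [exact: DS sn ts t0|exact: X0S Xs ts t0].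
have AY : (A `<=` Y)%fset.
  apply/fsubsetP => s sA; apply/memY; split.
    by apply: (fsubsetP (Delta_fset_subset (leq_addr _ _))); exact: (fsubsetP Am).
  exact: (bad_cyl X0bad sA).2.
have mC : measurable C by exact: measurable_cyl.
have mG : measurable (good m A (m + k).+1) by exact: measurable_cyl.
have -> : bad m A k `&` C = C by apply/setIidr.
have -> : bad m A k.+1 `&` C = C `\` good m A (m + k).+1.
  by rewrite /= !setDE setIAC (setIidr Cbad).
have muC : mu C = (fine (mu C))%:E by rewrite fineK // fin_num_measure.
have := mu_cyl_good (leq_addr k m) Ac Am Yc Yn AY; rewrite -/C.
have mCG : measurable (C `&` good m A (m + k).+1) by exact: measurableI.
have -> : mu (C `\` good m A (m + k).+1) =
    (mu C - mu (C `&` good m A (m + k).+1))%E.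
  apply: measureD => //; exact: le_lt_trans (probability_le1 mu mC) (ltry _).
have -> : mu (C `&` good m A (m + k).+1) =
    (fine (mu (C `&` good m A (m + k).+1)))%:E.
  by rewrite fineK // fin_num_measure.
rewrite muC -!EFinM -EFinB !lee_fin mulrBl mul1r => cle.
by rewrite lerD2l lerN2.
Qed.

(** The measures of the stages are at most the powers of [q], which tend to 0 because
    [0 <= q < 1]. *)
Lemma mu_bigcap_bad m A : simplicial_complex [set` A] ->
  (A `<=` Delta_fset m)%fset -> mu (\bigcap_k bad m A k) = 0%E.
Proof.
move=> Ac Am; set N := \bigcap_k _; set q : R := 1 - 2 ^- (2 ^ m).
have mN : measurable N by apply: bigcapT_measurable => k; exact: measurable_bad.
have p01 : 0 < (2 ^- (2 ^ m) : R) <= 1.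
  by rewrite invr_gt0 exprn_gt0 //= invf_le1 ?exprn_gt0 // exprn_ege1 // ler1n.
have q0 : 0 <= q by rewrite subr_ge0; case/andP: p01.
have q1 : `|q| < 1 by rewrite ger0_norm // ltrBlDr ltrDl; case/andP: p01.
have le_q k : (mu (bad m A k) <= (q ^+ k)%:E)%E.
  elim: k => [|k IH].
    by rewrite expr0; apply: probability_le1; exact: measurable_bad.
  apply: le_trans (mu_badS k Ac Am) _.
  by rewrite exprS EFinM lee_wpmul2l // lee_fin.
have muN : mu N = (fine (mu N))%:E by rewrite fineK // fin_num_measure.
have Nq k : fine (mu N) <= q ^+ k.
  rewrite -lee_fin -muN; apply: le_trans (le_q k).
  apply: le_measure; rewrite ?inE //; first exact: measurable_bad.
  by move=> X; exact.
rewrite muN; congr (_%:E); apply/eqP; rewrite eq_le fine_ge0 // andbT.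
have qcvg := cvg_expr q1.
rewrite -(cvg_lim (@Rhausdorff R) qcvg); apply: limr_ge;
  first by apply/cvg_ex; exists 0.
by near=> k; exact: Nq.
Unshelve. all: end_near. Qed.

Lemma bigcap_badP m A (X : cplx) : (\bigcap_k bad m A k) X <->
  [set` A] `<=` faces X /\ forall v, (m < v)%N -> ~ good m A v X.
Proof.
split=> [Xbad|[AX Xgood] k _].
  split=> [s sA|v mv]; first exact: (bad_cyl (Xbad 0%N I) sA).2.
  (* The vertex [v] is tested in passing from stage [v - m.+1] to the next one. *)
  by have [_] := Xbad (v - m.+1).+1 I; rewrite -addSn subnKC.
elim: k => [|k IH]; first by move=> s sA; split=> // _; exact: AX.
by split=> //; apply: Xgood; rewrite ltnS leq_addr.
Qed.

(** The complement is a union of null events indexed by the countably many pairs [(m, A)]. Pairs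
    that are not admissible, and numbers that encode no pair, receive the empty event. *)
Lemma measurable_Rado_prob1 :
  measurable [set X : cplx | is_Rado (faces X)] /\
  mu [set X : cplx | is_Rado (faces X)] = 1%E.
Proof.
set Rado := [set X | _].
pose F (i : nat * simplexes) : set cplx :=
  if `[< simplicial_complex [set` i.2] /\ (i.2 `<=` Delta_fset i.1)%fset >]
  then \bigcap_k bad i.1 i.2 k else set0.
have mF i : measurable (F i).
  rewrite /F; case: ifPn => // _.
  by apply: bigcapT_measurable => k; exact: measurable_bad.
have muF i : mu (F i) = 0%E.
  by rewrite /F; case: asboolP => [[? ?]|_]; [exact: mu_bigcap_bad|exact: measure0].
pose G n : set cplx := if choice.unpickle n is Some i then F i else set0.
have RadoC : ~` Rado = \bigcup_n G n.
  apply/seteqP; split=> [X XR|X [n _]]; last first.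
    rewrite /G; case: choice.unpickle => // -[m A]; rewrite /F.
    case: asboolP => // -[Ac Am] /bigcap_badP[AX Xgood] /is_Rado_good XR.
    by have [v mv] := XR m A Ac Am AX; exact: Xgood.
  apply: contrapT => XG; apply: XR; apply/is_Rado_good => m A Ac Am AX.
  apply: contrapT => Xgood; apply: XG; exists (choice.pickle (m, A)) => //.
  rewrite /G choice.pickleK /F; case: asboolP => [_|[]//].
  by apply/bigcap_badP; split=> // v mv gv; apply: Xgood; exists v.
have mG n : measurable (G n) by rewrite /G; case: choice.unpickle.
have mC : measurable (~` Rado) by rewrite RadoC; exact: bigcupT_measurable.
have mR : measurable Rado by rewrite -(setCK Rado); exact: measurableC.
split=> //; rewrite -(setCK Rado) probability_setC //.
suff -> : mu (~` Rado) = 0%E by rewrite sube0.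
rewrite RadoC; apply/negligibleP; first by rewrite -RadoC.
apply: negligible_bigcup => n; apply/negligibleP => //.
by rewrite /G; case: choice.unpickle => [i|]; [exact: muF|exact: measure0].
Qed.

End RandomComplex.

Local Open Scope ring_scope.

Theorem theorem11p2 (R : realType)
    (mu : probability (g_sigma_algebraType Zsets) R)
    (mu_Z : forall (n : nat) (Y : set {fset nat}),
       (1 <= n)%N -> subcomplex Y (Delta n) ->
       mu (Z Y n) = (2 ^- (H Y n))%:E)
    (V : choiceType) (K : set {fset V}) (K_Rado : is_Rado K) :
  (Zsets.-sigma.-measurable) (Rado_class K) /\ mu (Rado_class K) = 1%:E.
Proof.
(* Being isomorphic to [K] amounts to having the Rado property: this property passes along
   isomorphisms, and any two complexes having it are isomorphic. *)
rewrite (_ : Rado_class K = [set X : cplx | is_Rado (faces X)]).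
  exact: measurable_Rado_prob1.
apply/seteqP; split=> X /= XR; last exact: is_Rado_isomorphic.
have [Xc _] := facesP X.
by apply: isomorphic_is_Rado XR K_Rado => //; exact: countableP.
Qed.
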